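(* Let $H$ be a collection of probability measures on a measurable space $\mathcal{X}$, let $Q$ be a probability measure on $\mathcal{X}$ with generalized Lebesgue decomposition $Q=Q_a+Q_s$ with respect to $H$, and let $U:[0,\infty]\to[-\infty,\infty]$ be measurable. Let $\varepsilon^*$ be a $U$-optimal e-value for $H$. - Strict monotonicity. If $U$ is strictly increasing and $Q_a(\mathcal{X})>0$, then $\sup_{P\in H}\mathrm{E}^P[\varepsilon^*]=1$. - Uniqueness. If $U$ is strictly concave, then the $U$-optimal e-value is unique up to $Q_a$-almost sure equality. - Positivity. If $U(0)=-\infty$, then $\varepsilon^*>0$, $Q_a$-almost surely.
   Context: Notation: $\mathrm{E}^\mu[f]=\int f\,d\mu$ for any nonnegative measure $\mu$. Strict monotonicity and strict concavity of $U$ are understood on $[0,\infty)$ (valid e-values are finite $Q_a$-a.s., so $U(\infty)$ is immaterial). An event is $H$-negligible if it has probability zero under every $P\in H$. The generalized Lebesgue decomposition of $Q$ with respect to $H$ is $Q=Q_a+Q_s$, where the nonnegative measure $Q_s$ is concentrated on an $H$-negligible event and the nonnegative measure $Q_a$ assigns zero mass to every $H$-negligible event. The class of valid e-values for $H$ is $\mathcal{E}(H)=\{\varepsilon:\mathcal{X}\to[0,\infty]\ \text{measurable}: \mathrm{E}^P[\varepsilon]\le 1\ \text{for all } P\in H\}$. A valid e-value $\varepsilon^*\in\mathcal{E}(H)$ is $U$-optimal (against $Q_a$) if, for every $\varepsilon\in\mathcal{E}(H)$, $\mathrm{E}^{Q_a}[U(\varepsilon^* )-U(\varepsilon)]$ is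 well-defined and $\ge 0$. Here ''well-defined'' means that the integrand avoids an ambiguous $\infty-\infty$ $Q_a$-almost surely, and that its positive part or its negative part has finite $Q_a$-expectation. *)

(* Defs.v *)
From HB Require Import structures.
From mathcomp Require Import all_boot all_order all_algebra.
From mathcomp Require Import all_classical all_reals all_analysis.
From mathcomp Require Import measurable_realfun.

Set Implicit Arguments.
Unset Strict Implicit.
Unset Printing Implicit Defensive.

Import Order.TTheory GRing.Theory Num.Theory.
Import numFieldNormedType.Exports.

Local Open Scope classical_set_scope.
Local Open Scope ring_scope.
Local Open Scope ereal_scope.

Definition H_negligible (d : measure_display) (X : measurableType d)
    (R : realType) (H : set (probability X R)) (N : set X) : Prop :=
  measurable N /\ forall P, H P -> P N = 0.

Definition lebesgue_decomposition_wrt (d : measure_display)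
    (X : measurableType d) (R : realType) (H : set (probability X R))
    (Q : probability X R) (Qa Qs : {measure set X -> \bar R}) : Prop :=
  [/\ forall A, measurable A -> Q A = Qa A + Qs A,
      exists2 N, H_negligible H N & Qs (~` N) = 0
    & forall N, H_negligible H N -> Qa N = 0].

Definition valid_evalue (d : measure_display) (X : measurableType d)
    (R : realType) (H : set (probability X R)) (e : X -> \bar R) : Prop :=
  [/\ measurable_fun setT e,
      forall x, 0 <= e x
    & forall P, H P -> \int[P]_x e x <= 1].

(* [y +? - z] says that [y - z] is not of the form oo - oo.  Off that case the
   library's totalized subtraction is the usual one, and once the positive or
   the negative part has a finite integral so is its totalized integral. *)
Definition difference_well_defined (d : measure_display)
    (X : measurableType d) (R : realType) (mu : {measure set X -> \bar R})
    (f g : X -> \bar R) : Prop :=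
  {ae mu, forall x, f x +? - g x} /\
  (\int[mu]_x ((fun y => f y - g y)^\+ x) < +oo \/
   \int[mu]_x ((fun y => f y - g y)^\- x) < +oo).

(* Only the values of [U] on [0, +oo] matter, since e-values are nonnegative. *)
Definition U_optimal (d : measure_display) (X : measurableType d)
    (R : realType) (H : set (probability X R))
    (Qa : {measure set X -> \bar R}) (U : \bar R -> \bar R)
    (es : X -> \bar R) : Prop :=
  valid_evalue H es /\
  forall e, valid_evalue H e ->
    difference_well_defined Qa (U \o es) (U \o e) /\
    0 <= \int[Qa]_x (U (es x) - U (e x)).

Definition strictly_increasing_on_nonneg (R : realType)
    (U : \bar R -> \bar R) : Prop :=
  forall x y : R, (0 <= x)%R -> (x < y)%R -> U x%:E < U y%:E.

(* The inequality forces [U] to be finite on ]0, +oo[ and [U 0 < +oo], so the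
   value given to +oo - oo on the left-hand side is immaterial. *)
Definition strictly_concave_on_nonneg (R : realType)
    (U : \bar R -> \bar R) : Prop :=
  forall x y t : R, (0 <= x)%R -> (0 <= y)%R -> x <> y ->
    (0 < t)%R -> (t < 1)%R ->
    t%:E * U x%:E + (1 - t)%:E * U y%:E < U (t * x + (1 - t) * y)%:E.

(* Main.v *)
Require Import Defs.
From HB Require Import structures.
From mathcomp Require Import all_boot all_order all_algebra.
From mathcomp Require Import all_classical all_reals all_analysis.
From mathcomp Require Import measurable_realfun.
From mathcomp Require Import lra.

Set Implicit Arguments.
Unset Strict Implicit.
Unset Printing Implicit Defensive.

Import Order.TTheory GRing.Theory Num.Theory.
Import numFieldNormedType.Exports.

Local Open Scope classical_set_scope.
Local Open Scope ring_scope.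
Local Open Scope ereal_scope.

(** All three claims compare [es] with one well-chosen competitor, and all that
    optimality is used for is that [U (es x) - U (e x)] has a nonnegative
    integral, or is well-defined.

    Two remarks make the extended-real bookkeeping painless.  A valid e-value is
    finite [Qa]-almost surely, because the event where it is infinite is
    [H]-negligible ([valid_evalue_ae_fin_num]).  And with the convention
    [+oo - +oo = -oo], a nonnegative integral forces the negative part to have a
    finite integral, so if [f + g <= 0] almost surely while [f] and [g] both
    have a nonnegative integral, then [f] and [g] are integrable and
    [f + g = 0] almost surely ([ae_add_eq0]).

    Strict monotonicity: were the supremum [m] smaller than 1, the competitor
    [es + (1 - m)] would still be valid; its utility is strictly larger almost
    surely, so the utility gain of [es] over it is negative with a nonnegative
    integral, which is only possible if [Qa] vanishes.

    Uniqueness: if [e] and [es] are both optimal, compare both with their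
    midpoint [z].  By strict concavity [(U e - U z) + (U es - U z)] is at most
    0, and negative where [e] and [es] differ
    ([strictly_concave_midpoint_lt0]); as each summand has a nonnegative
    integral, [ae_add_eq0] says that the sum vanishes almost surely.

    Positivity: compare [es] with itself.  Where [es] is 0 the difference
    [U es - U es] is the ambiguous [-oo - -oo], so optimality makes this event
    [Qa]-null. *)

(** * Integrals of extended-real functions *)

Lemma lt_sube_lt0 (R : realType) (u v : \bar R) : u < v -> u - v < 0.
Proof.
case: u v => [u| |] [v| |] //= uv; rewrite ?ltNy0 //.
by rewrite -EFinB lte_fin subr_lt0.
Qed.

(** The integral is the difference of those of the positive and negative parts,
    and [x - +oo = -oo] for every [x], [+oo] included. *)
Lemma funeneg_integral_lty (d : measure_display) (X : measurableType d)
    (R : realType) (mu : {measure set X -> \bar R}) (f : X -> \bar R) :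
  0 <= \int[mu]_x f x -> \int[mu]_x f^\- x < +oo.
Proof.
rewrite integralE => If; rewrite ltey; apply/eqP => E.
by rewrite E /= addeNy in If.
Qed.

(** The positive part of [f] is dominated by the negative part of [g], whose
    integral is finite. *)
Lemma integrable_le_opp (d : measure_display) (X : measurableType d)
    (R : realType) (mu : {measure set X -> \bar R}) (f g : X -> \bar R) :
  measurable_fun setT f -> measurable_fun setT g ->
  {ae mu, forall x, f x + g x <= 0} ->
  0 <= \int[mu]_x f x -> 0 <= \int[mu]_x g x -> mu.-integrable setT f.
Proof.
move=> mf mg fg If Ig; apply/integrableP; split => //.
rewrite -[fun x => `|f x|]/(abse \o f) fune_abse ge0_integralD //; last 2 first.
- exact: measurable_funepos.
- exact: measurable_funeneg.
apply: lte_add_pinfty; last exact: funeneg_integral_lty.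
apply: le_lt_trans (funeneg_integral_lty Ig).
apply: ae_ge0_le_integral => //.
- exact: measurable_funepos.
- exact: measurable_funeneg.
apply: filterS fg => x + _; rewrite funeposE funenegE.
case: (f x) (g x) => [a| |] [b| |] //= h;
  rewrite ?ge_max ?le_max ?lexx ?leey ?leNye ?orbT //.
by rewrite andbT; apply/orP; left; move: h; rewrite -EFinD !lee_fin; lra.
Qed.

(** Once [f] and [g] are known to be integrable, the integral of [f + g] is both
    nonnegative and nonpositive, so that of [|f + g| = - (f + g)] is 0.  Taking
    [g] to be 0 covers a single function. *)
Lemma ae_add_eq0 (d : measure_display) (X : measurableType d)
    (R : realType) (mu : {measure set X -> \bar R}) (f g : X -> \bar R) :
  measurable_fun setT f -> measurable_fun setT g ->
  {ae mu, forall x, f x + g x <= 0} ->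
  0 <= \int[mu]_x f x -> 0 <= \int[mu]_x g x ->
  {ae mu, forall x, f x + g x = 0}.
Proof.
move=> mf mg fg If Ig.
have intf : mu.-integrable setT f by exact: integrable_le_opp fg If Ig.
have intg : mu.-integrable setT g.
  apply: (integrable_le_opp mg mf _ Ig If).
  by apply: filterS fg => x; rewrite addeC.
have mfg : measurable_fun setT (f \+ g) by exact: emeasurable_funD.
have : ae_eq mu setT (f \+ g) (cst 0); last by apply: filterS => x; exact.
apply/(ae_eq_integral_abs _ measurableT) => //; apply/eqP; rewrite eq_le.
rewrite integral_ge0 ?andbT //.
have -> : \int[mu]_x `|(f \+ g) x| = \int[mu]_x - (f \+ g) x.
  apply: ae_eq_integral => //; first exact: measurableT_comp.
    exact: measurableT_comp.
  by apply: filterS fg => x h _; rewrite lee0_abs.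
rewrite integralN; last by apply: integrable_add_def => //; exact: integrableD.
by rewrite leeNl oppe0 integralD // adde_ge0.
Qed.

(** * E-values *)

Lemma measurable_comp_evalue (d : measure_display) (X : measurableType d)
    (R : realType) (H : set (probability X R))
    (U : \bar R -> \bar R) (e : X -> \bar R) :
  measurable_fun [set u : \bar R | 0 <= u] U ->
  valid_evalue H e -> measurable_fun setT (U \o e).
Proof.
move=> mU [me e0 _]; apply: measurable_comp mU me.
- have := @emeasurable_fun_c_infty _ _ R setT id measurableT
    (@measurable_id _ _ setT) 0.
  by rewrite setTI.
- by move=> _ [x _ <-]; exact: e0.
Qed.

(** For each [P] in [H] the integral of [e] is finite, so the event where [e] is
    [+oo] is [P]-null, hence [H]-negligible. *)
Lemma valid_evalue_ae_fin_num (d : measure_display) (X : measurableType d)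
    (R : realType) (H : set (probability X R))
    (Qa : {measure set X -> \bar R}) (e : X -> \bar R) :
  (forall N, H_negligible H N -> Qa N = 0) ->
  valid_evalue H e -> {ae Qa, forall x, e x \is a fin_num}.
Proof.
move=> Qa0 [me e0 e1].
have mE : measurable (e @^-1` [set +oo]).
  by rewrite -[X in measurable X]setTI; exact: me.
exists (e @^-1` [set +oo]); split => //.
- apply: Qa0; split => // P HP; apply/negligibleP => //.
  have : P.-integrable setT e.
    apply/integrableP; split => //; apply: le_lt_trans (ltry 1).
    by under eq_integral do rewrite gee0_abs //; exact: e1.
  move/(integrable_ae measurableT).
  by apply: negligibleS => x /= ex; rewrite ex => /(_ I).
- move=> x /= /negP; rewrite ge0_fin_numE // -leNgt leye_eq.
  by move/eqP.
Qed.

Lemma valid_evalue_midpoint (d : measure_display) (X : measurableType d)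
    (R : realType) (H : set (probability X R))
    (e f : X -> \bar R) :
  valid_evalue H e -> valid_evalue H f ->
  valid_evalue H (fun x => 2^-1%:E * (e x + f x)).
Proof.
move=> [me e0 e1] [mf f0 f1]; have half0 : 0 <= (2^-1)%:E :> \bar R.
  by rewrite lee_fin invr_ge0.
have mef : measurable_fun setT (e \+ f) by exact: emeasurable_funD.
split.
- exact: measurable_funeM.
- by move=> x; rewrite mule_ge0 // adde_ge0.
- move=> P HP; rewrite ge0_integralZl //; last by move=> x _; rewrite adde_ge0.
  rewrite ge0_integralD //.
  apply: (@le_trans _ _ (2^-1%:E * (1 + 1))).
    by apply: lee_wpmul2l => //; apply: leeD; [exact: e1|exact: f1].
  by rewrite -EFinD -EFinM lee_fin; lra.
Qed.

Lemma valid_evalue_shift (d : measure_display) (X : measurableType d)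
    (R : realType) (H : set (probability X R))
    (e : X -> \bar R) (s : R) :
  valid_evalue H e -> (0 <= s)%R ->
  (forall P, H P -> \int[P]_x e x <= (1 - s)%:E) ->
  valid_evalue H (fun x => e x + s%:E).
Proof.
move=> [me e0 _] s0 es; split.
- by apply: emeasurable_funD => //; exact: measurable_cst.
- by move=> x; rewrite adde_ge0.
- move=> P HP; rewrite ge0_integralD //.
  have -> : \int[P]_x s%:E = s%:E.
    transitivity (s%:E * P setT); first exact: integral_cst.
    by rewrite probability_setT mule1.
  by rewrite -leeBrDr // -EFinB; exact: es.
Qed.

(** * Strict concavity *)

(** This is strict concavity at [t = 1/2], in a form that also holds when [U]
    takes infinite values.  [U z] cannot be [-oo]; if it is [+oo], or if [U x]
    or [U y] is [-oo], the left-hand side is [-oo]; otherwise strict concavity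
    makes [U x] and [U y] real. *)
Lemma strictly_concave_midpoint_lt0 (R : realType) (U : \bar R -> \bar R)
    (x y : R) : strictly_concave_on_nonneg U ->
  (0 <= x)%R -> (0 <= y)%R -> x <> y ->
  let z := (2^-1%:E * (x%:E + y%:E)) in
  (U x%:E - U z) + (U y%:E - U z) < 0.
Proof.
move=> cU x0 y0 xy /=.
have := cU x y 2^-1%R x0 y0 xy.
rewrite (_ : 1 - 2^-1 = 2^-1 :> R)%R; last by lra.
rewrite -mulrDr invr_gt0 ltr0n invf_lt1 // ltr1n -EFinD -EFinM.
move=> /(_ erefl erefl).
have half0 : (0 < 2^-1 :> R)%R by rewrite invr_gt0.
case: (U (2^-1 * (x + y))%:E) (U x%:E) (U y%:E) => [c| |] [a| |] [b| |] //=.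
all: rewrite ?gt0_muley ?gt0_muleNy ?lte_fin //= ?ltNyr ?ltNy0 //.
all: rewrite -?EFinM -?EFinD -?EFinB ?lte_fin /=.
lra.
Qed.

(** * Optimal e-values *)

Lemma strictly_increasing_optimal_sup (d : measure_display)
    (X : measurableType d) (R : realType) (H : set (probability X R))
    (Qa : {measure set X -> \bar R}) (U : \bar R -> \bar R)
    (es : X -> \bar R) :
  (forall N, H_negligible H N -> Qa N = 0) ->
  measurable_fun [set u : \bar R | 0 <= u] U -> U_optimal H Qa U es ->
  strictly_increasing_on_nonneg U -> 0 < Qa setT ->
  ereal_sup [set \int[P]_x es x | P in H] = 1.
Proof.
move=> Qa0 mU [es_valid opt] incU QaT; have [mes es0 es1] := es_valid.
set m := ereal_sup _.
have int_le P : H P -> \int[P]_x es x <= m.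
  by move=> HP; apply: ereal_sup_ubound; exists P.
have m1 : m <= 1 by apply: ge_ereal_sup => _ [P HP <-]; exact: es1.
(* If [H] is empty then every event is [H]-negligible and [Qa] vanishes. *)
have [P HP] : exists P, H P.
  apply: contrapT => H0; move: QaT; rewrite Qa0 ?ltxx //.
  by split => // P HP; case: H0; exists P.
have m0 : 0 <= m by apply: le_trans (int_le P HP); exact: integral_ge0.
apply/eqP; rewrite eq_le m1 leNgt; apply/negP => m_lt1.
have mfin : m \is a fin_num by rewrite ge0_fin_numE // (lt_trans m_lt1) ?ltry.
have s0 : (0 < 1 - fine m)%R by rewrite subr_gt0 -lte_fin fineK.
have e_valid : valid_evalue H (fun x => es x + (1 - fine m)%:E).
  apply: valid_evalue_shift (ltW s0) _ => // P' HP'.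
  by rewrite opprB addrCA subrr addr0 fineK //; exact: int_le.
have [_ gain] := opt _ e_valid.
have lt0 : {ae Qa, forall x, U (es x) - U (es x + (1 - fine m)%:E) < 0}.
  apply: filterS (valid_evalue_ae_fin_num Qa0 es_valid) => x.
  move: (es0 x); case: (es x) => // a a0 _.
  have := incU a (a + (1 - fine m))%R a0; rewrite ltrDl -EFinD => /(_ s0).
  exact: lt_sube_lt0.
have eq0 : {ae Qa, forall x,
    U (es x) - U (es x + (1 - fine m)%:E) + cst 0 x = 0}.
  apply: ae_add_eq0 => //.
  - apply: emeasurable_funB.
      exact: measurable_comp_evalue mU es_valid.
    exact: measurable_comp_evalue mU e_valid.
  - by apply: filterS lt0 => x; rewrite adde0; exact: ltW.
  - by rewrite integral0.
have : {ae Qa, forall x : X, False}.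
  by apply: filterS2 lt0 eq0 => x h; rewrite /= adde0 => E; rewrite E ltxx in h.
case=> N [mN N0 subN]; move: QaT; rewrite (_ : setT = N) ?N0 ?ltxx //.
by apply/esym/seteqP; split => // x _; apply: subN.
Qed.

Lemma strictly_concave_optimal_unique (d : measure_display)
    (X : measurableType d) (R : realType) (H : set (probability X R))
    (Qa : {measure set X -> \bar R}) (U : \bar R -> \bar R)
    (es e : X -> \bar R) :
  (forall N, H_negligible H N -> Qa N = 0) ->
  measurable_fun [set u : \bar R | 0 <= u] U -> U_optimal H Qa U es ->
  strictly_concave_on_nonneg U -> U_optimal H Qa U e ->
  {ae Qa, forall x, e x = es x}.
Proof.
move=> Qa0 mU [es_valid opt] cU [e_valid opte].
have z_valid := valid_evalue_midpoint e_valid es_valid.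
have [_ gain] := opt _ z_valid; have [_ gaine] := opte _ z_valid.
set z := fun x => _ in z_valid gain gaine.
have lt0 : {ae Qa, forall x,
    e x <> es x -> (U (e x) - U (z x)) + (U (es x) - U (z x)) < 0}.
  apply: filterS2 (valid_evalue_ae_fin_num Qa0 e_valid)
    (valid_evalue_ae_fin_num Qa0 es_valid) => x.
  have [_ /(_ x) e0 _] := e_valid; have [_ /(_ x) es0 _] := es_valid.
  rewrite /z; case: (e x) (es x) e0 es0 => [a| |] [b| |] // a0 b0 _ _ ab.
  by apply: strictly_concave_midpoint_lt0 => // E; apply: ab; rewrite E.
have le0 : {ae Qa, forall x, (U (e x) - U (z x)) + (U (es x) - U (z x)) <= 0}.
  apply: filterS2 lt0 (valid_evalue_ae_fin_num Qa0 es_valid) => x.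
  have [E _ esfin|ne /(_ ne) /ltW //] := pselect (e x = es x).
  have zE : z x = es x.
    by rewrite /z E -(fineK esfin) -EFinD -EFinM; congr EFin; lra.
  rewrite E zE; case: (U (es x)) => [a| |] //=; rewrite ?addeNy ?leNye //.
  by rewrite -EFinB -EFinD lee_fin; lra.
have := ae_add_eq0 _ _ le0 gaine gain.
have mz f : valid_evalue H f ->
    measurable_fun setT (fun x => U (f x) - U (z x)).
  move=> vf; apply: emeasurable_funB.
    exact: measurable_comp_evalue mU vf.
  exact: measurable_comp_evalue mU z_valid.
move=> /(_ (mz _ e_valid) (mz _ es_valid)) eq0.
apply: filterS2 lt0 eq0 => x h E; apply: contrapT => /h.
by rewrite E ltxx.
Qed.

Lemma optimal_ae_gt0 (d : measure_display) (X : measurableType d)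
    (R : realType) (H : set (probability X R))
    (Qa : {measure set X -> \bar R}) (U : \bar R -> \bar R)
    (es : X -> \bar R) :
  U_optimal H Qa U es -> U 0 = -oo -> {ae Qa, forall x, 0 < es x}.
Proof.
move=> [es_valid opt] U0; have [_ es0 _] := es_valid.
have [[wd _] _] := opt _ es_valid.
apply: filterS wd => x /=; rewrite lt0e es0 andbT => h.
by apply/eqP => E; rewrite E U0 in h.
Qed.

Theorem proposition6 (d : measure_display) (X : measurableType d)
    (R : realType) (H : set (probability X R)) (Q : probability X R)
    (Qa Qs : {measure set X -> \bar R}) (U : \bar R -> \bar R)
    (es : X -> \bar R)
    (hQ : lebesgue_decomposition_wrt H Q Qa Qs)
    (mU : measurable_fun [set u : \bar R | 0 <= u] U)
    (hes : U_optimal H Qa U es) :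
  [/\ strictly_increasing_on_nonneg U -> 0 < Qa setT ->
        ereal_sup [set \int[P]_x es x | P in H] = 1,
      strictly_concave_on_nonneg U ->
        forall e, U_optimal H Qa U e -> {ae Qa, forall x, e x = es x}
    & U 0 = -oo -> {ae Qa, forall x, 0 < es x}].
Proof.
have [_ _ Qa0] := hQ; split.
- exact: strictly_increasing_optimal_sup Qa0 mU hes.
- by move=> cU e; exact: strictly_concave_optimal_unique Qa0 mU hes cU.
- exact: optimal_ae_gt0 hes.
Qed.
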